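(* Let $K$ be a perfect field of characteristic $p\ge 0$, let $n\ge 1$, and let $\mathbb{X}$ be a 0-dimensional scheme in $\mathbb{P}^n_K$ whose homogeneous vanishing ideal $I_{\mathbb{X}}\subseteq P=K[X_0,\dots,X_n]$ is a proper monomial ideal of $P$, minimally generated by terms $t_1,\dots,t_r\in\mathbb{T}^{n+1}$. (a) The ideal $I_{\mathbb{X}}^{\mathrm{diff}}$ is a monomial ideal contained in $I_{\mathbb{X}}$. (b) For $1\le j\le r$ write $t_j=X_0^{\alpha_{0j}}\cdots X_n^{\alpha_{nj}}$. For $2\le k\le n+1$ and $1\le j_1\le\cdots\le j_k\le r$ define $t_{j_1,\dots,j_k}:=X_0^{\beta_0}\cdots X_n^{\beta_n}$, where, for $i=0,\dots,n$, $$ \beta_i:=\begin{cases} 0 & \text{if } \alpha_{ij_1}=\dots=\alpha_{ij_k}=0,\\ \alpha_{ij_1} & \text{if } \alpha_{ij_1}=\dots=\alpha_{ij_k}>0 \text{ and } p\mid\alpha_{ij_1},\\ \alpha_{ij_1}+1 & \text{if } \alpha_{ij_1}=\dots=\alpha_{ij_k}>0 \text{ and } p\nmid\alpha_{ij_1},\\ \max\{\alpha_{ij_1},\dots,\alpha_{ij_k}\} & \text{otherwise.} \end{cases} $$ Then $$ I_{\mathbb{X}}^{\mathrm{diff}}=\langle\, t_{j_1,\dots,j_k}\mid 1\le j_1\le\cdots\le j_k\le r;\ 2\le k\le n+1\,\rangle . $$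
   Context: $P=K[X_0,\dots,X_n]$ is the standard graded polynomial ring and $\mathbb{T}^{n+1}=\{X_0^{\alpha_0}\cdots X_n^{\alpha_n}\mid(\alpha_0,\dots,\alpha_n)\in\mathbb{N}^{n+1}\}$ with $\mathbb{N}=\{0,1,2,\dots\}$. The homogeneous vanishing ideal $I_{\mathbb{X}}$ of a 0-dimensional (closed sub)scheme $\mathbb{X}\subseteq\mathbb{P}^n_K$ is the saturated homogeneous ideal of $P$ defining $\mathbb{X}$. $K$-linear differential operators on $P$: $D_P^0=\operatorname{Hom}_P(P,P)$ (multiplications by elements of $P$), and for $m\ge1$, $D_P^m=\{\delta\in\operatorname{Hom}_K(P,P)\mid \delta\circ\mu_f-\mu_f\circ\delta\in D_P^{m-1}\text{ for all } f\in P\}$, where $\mu_f$ is multiplication by $f$. For an ideal $I\subseteq P$, $I^{\mathrm{diff}}:=I^{\langle 2\rangle}=\{f\in P\mid\delta(f)\in I\text{ for all }\delta\in D_P^1\}$ (the second differential power of $I$). Convention: if $p=0$, then $p\nmid a$ for every positive integer $a$. *)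

(* Defs.v *)
From HB Require Import structures.
From mathcomp Require Import all_boot all_order all_algebra all_field.
From mathcomp Require Import boolp classical_sets.
From mathcomp.multinomials Require Import mpoly.

Set Implicit Arguments.
Unset Strict Implicit.
Unset Printing Implicit Defensive.

Import GRing.Theory.
Local Open Scope classical_set_scope.
Local Open Scope ring_scope.

Definition perfect_field (K : fieldType) : Prop :=
  forall q : {poly K}, irreducible_poly q -> separable_poly q.

Definition has_characteristic (K : fieldType) (p : nat) : Prop :=
  if p == 0%N then [pchar K] =i pred0 else p \in [pchar K].

Section Ideals.

Variable R : comNzRingType.
Implicit Types I : set R.

Definition is_ideal I : Prop :=
  [/\ I 0, forall f g, I f -> I g -> I (f + g) & forall a f, I f -> I (a * f)].

Definition is_proper I : Prop := ~ I 1.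

Definition is_prime I : Prop :=
  [/\ is_ideal I, is_proper I & forall f g, I (f * g) -> I f \/ I g].

Definition ideal_gen (G : set R) : set R := smallest is_ideal G.

End Ideals.

Section DifferentialPowers.

Variables (K : fieldType) (A : comAlgType K).

(* Linearity over A^o is linearity over A itself, so that the base case is
   Hom_A(A, A); in the other case linearity is over K. *)
Fixpoint diff_op (m : nat) : set (A -> A) :=
  match m with
  | 0 => [set delta | linear (delta : A^o -> A^o)]
  | m'.+1 => [set delta | linear delta /\
      forall f, diff_op m' (fun g => delta (f * g) - f * delta g)]
  end.

(* Meaningful for k >= 1 only. *)
Definition diff_power (k : nat) (I : set A) : set A :=
  [set f | forall delta, diff_op k.-1 delta -> I (delta f)].

Definition diff_ideal (I : set A) : set A := diff_power 2 I.

End DifferentialPowers.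

Section Projective.

Variables (K : fieldType) (n : nat).
Notation P := {mpoly K[n.+1]}.
Implicit Types I q : set P.

Definition homogeneous I : Prop :=
  forall f, I f -> forall d : nat, I (pihomog mdeg d f).

(* The saturation of I with respect to the irrelevant ideal consists of the f
   such that every variable has a power multiplying f into I. *)
Definition saturated I : Prop :=
  forall f, (forall i : 'I_n.+1, exists k, I ('X_i ^+ k * f)) -> I f.

(* Closed subschemes of the projective n-space over K correspond bijectively to
   saturated homogeneous ideals (the unit ideal gives the empty subscheme). *)
Record closed_subscheme := ClosedSubscheme {
  vanishing_ideal : set P;
  vanishing_ideal_ideal : is_ideal vanishing_ideal;
  vanishing_ideal_homogeneous : homogeneous vanishing_ideal;
  vanishing_ideal_saturated : saturated vanishing_ideal
}.

(* The points of Proj(P / I): homogeneous primes of P above I that do not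
   contain the irrelevant ideal. *)
Definition point_of (X : closed_subscheme) q : Prop :=
  [/\ is_prime q, homogeneous q, exists i : 'I_n.+1, ~ q 'X_i
    & vanishing_ideal X `<=` q].

Definition has_chain (X : closed_subscheme) (d : nat) : Prop :=
  exists c : 'I_d.+1 -> set P, (forall i, point_of X (c i)) /\
    (forall i j : 'I_d.+1, (i < j)%N -> c i `<` c j).

(* Irreducible closed subsets of X are the closures of its points, so this is
   the topological dimension; every chain of length > d contains one of length
   d + 1. *)
Definition has_dim (X : closed_subscheme) (d : nat) : Prop :=
  has_chain X d /\ ~ has_chain X d.+1.

Definition monomial_ideal I : Prop :=
  exists S : set 'X_{1..n.+1}, I = ideal_gen [set 'X_[m] | m in S].

Definition minimally_generated_by (r : nat) (t : 'I_r -> 'X_{1..n.+1}) I : Prop :=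
  I = ideal_gen [set 'X_[t j] | j in setT] /\
  forall J : set 'I_r, I = ideal_gen [set 'X_[t j] | j in J] -> J = setT.

(* The exponent beta_i computed from the list alpha_{i j_1}, ..., alpha_{i j_k}.
   For p = 0, [p %| a] means a = 0, hence fails for a > 0. *)
Definition mixed_exponent (p : nat) (s : seq nat) : nat :=
  let a := head 0%N s in
  if all (pred1 a) s then
    if a == 0%N then 0%N else if (p %| a)%N then a else a.+1
  else (\max_(b <- s) b)%N.

Definition mixed_term (p r : nat) (t : 'I_r -> 'X_{1..n.+1}) (js : seq 'I_r)
    : 'X_{1..n.+1} :=
  [multinom mixed_exponent p [seq t j i | j <- js] | i < n.+1].

Definition mixed_terms (p r : nat) (t : 'I_r -> 'X_{1..n.+1}) : set P :=
  [set f | exists js : seq 'I_r,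
     [/\ (2 <= size js <= n.+1)%N, sorted leq [seq val j | j <- js]
       & f = 'X_[mixed_term p t js]]].

End Projective.

(* Main.v *)
(* A first-order operator on P is f |-> f * delta(1) + sum_i d_i f * d(X_i) with
   d = delta - delta(1), so f lies in I^diff iff f and all its partial
   derivatives lie in I.  When I is monomial this can be read off the support:
   I^diff is spanned by the X^m in I such that X^m / X_i lies in I whenever p
   does not divide m_i.  The exponent beta_i is the least value compatible with
   this condition and with divisibility by all of t_{j_1}, ..., t_{j_k}.
   Conversely, given such an m, choose for every i a generator t_{j(i)} dividing
   X^m, and even X^m / X_i if p does not divide m_i; the mixed term of the n + 1
   generators t_{j(0)}, ..., t_{j(n)} then divides X^m. *)

Require Import Defs.
From HB Require Import structures.
From mathcomp Require Import all_boot all_order all_algebra all_field.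
From mathcomp Require Import boolp classical_sets ring.
From mathcomp.multinomials Require Import mpoly.

Set Implicit Arguments.
Unset Strict Implicit.
Unset Printing Implicit Defensive.

Import GRing.Theory.

Local Open Scope classical_set_scope.
Local Open Scope ring_scope.

(** The support condition defines an ideal containing the generators; conversely, it puts every term
    of [f] into the ideal, and [f] is the sum of its terms. *)
Lemma ideal_gen_monomialsP (R : comNzRingType) (n : nat) (T : Type)
    (t : T -> 'X_{1..n}) (J : set T) (f : {mpoly R[n]}) :
  ideal_gen [set 'X_[t j] | j in J] f <->
  forall m, m \in msupp f -> exists2 j, J j & (t j <= m)%MM.
Proof.
split.
  pose X : set {mpoly R[n]} :=
    [set g | forall m, m \in msupp g -> exists2 j, J j & (t j <= m)%MM].
  suff subX : ideal_gen [set 'X_[t j] | j in J] `<=` X by exact: subX.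
  apply: smallest_sub; last first.
    by move=> _ [j Jj <-] m /mem_msuppXP <-; exists j => //; exact: lepm_refl.
  split=> [m|g h If Ig m /msuppD_le|a g If m /msuppM_le].
  - by rewrite mcoeff_msupp mcoeff0 eqxx.
  - by rewrite mem_cat => /orP[/If|/Ig].
  - case/allpairsP=> -[m1 m2] /= [_ /If [j Jj le_j] ->].
    by exists j => //; apply: lepm_trans le_j (lem_addl _ _).
move=> suppf I [[I0 ID IM] subI]; rewrite [f]mpolyE big_seq.
apply: big_ind => // m /suppf[j Jj le_j].
rewrite -(submK le_j) mpolyXD -mul_mpolyC mulrA.
by apply: IM; apply: subI; exists j.
Qed.

Lemma diff_op1_mul (K : fieldType) (A : comAlgType K) (delta : A -> A) f g :
  diff_op 1 delta ->
  delta (f * g) = f * delta g + delta f * g - f * g * delta 1.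
Proof.
move=> [lin_delta comm_lin].
have d0 : delta 0 = 0.
  by have := lin_delta (-1) 0 0; rewrite scaler0 addr0 scaleN1r addNr.
(* The commutator of [delta] with [f] is [A]-linear, so its value at [g] is [g] times its value at
   1. *)
have := comm_lin f g 1 0; rewrite /= !addr0 mulr0 d0 mulr0 subr0 addr0.
rewrite /GRing.scale /= !mulr1 mulrBr => /eqP.
by rewrite subr_eq => /eqP ->; ring.
Qed.

(** Both sides are derivations that agree on the variables, so the set where they agree is closed
    under products and linear combinations. *)
Lemma derivation_mpolyE (R : comNzRingType) (n : nat)
    (d : {mpoly R[n]} -> {mpoly R[n]}) :
  linear d -> (forall f g, d (f * g) = f * d g + d f * g) ->
  forall f, d f = \sum_(i < n) f^`M(i) * d 'X_i.
Proof.
move=> lin_d leib.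
have d0 : d 0 = 0.
  by have := lin_d (-1) 0 0; rewrite scaler0 addr0 scaleN1r addNr.
have d1 : d 1 = 0.
  by have /eqP := leib 1 1; rewrite !mulr1 mul1r -subr_eq subrr => /eqP.
pose Q f := d f = \sum_(i < n) f^`M(i) * d 'X_i.
have Q1 : Q 1 by rewrite /Q d1 big1 // => i _; rewrite mderivC mul0r.
have QM f g : Q f -> Q g -> Q (f * g).
  rewrite /Q leib => -> ->; rewrite mulr_sumr mulr_suml -big_split /=.
  by apply: eq_bigr => i _; rewrite mderivM mulrDl addrC mulrAC !mulrA.
have QX i : Q 'X_i.
  rewrite /Q (bigD1 i) //= mderivX mnm1E eqxx scale1r.
  rewrite -[X in (X - _)%MM]add0m addmK mpolyX0 mul1r.
  rewrite big1 ?addr0 // => j /negPf; rewrite eq_sym mderivX mnm1E => ->.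
  by rewrite scale0r mul0r.
elim/mpolyind=> [|c m f _ _ Qf].
  by rewrite d0 big1 // => i _; rewrite mderiv0 mul0r.
have Qm : Q 'X_[m].
  rewrite mpolyXE_id; apply: big_ind => // i _.
  by elim: (m i) => [|k IHk] //; rewrite exprS; apply: QM.
rewrite lin_d Qf Qm scaler_sumr -big_split /=; apply: eq_bigr => i _.
by rewrite mderivD mderivZ mulrDl scalerAl.
Qed.

Lemma diff_idealP (K : fieldType) (n : nat) (I : set {mpoly K[n]}) f :
  is_ideal I -> diff_ideal I f <-> I f /\ forall i, I f^`M(i).
Proof.
move=> [I0 ID IM]; split=> [If|[If Idf] delta /[dup] diff_delta [lin_delta _]].
  split=> [|i].
    apply: (If id); split=> // g a u v /=.
    by rewrite !subrr scaler0 addr0.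
  (* The commutator of a partial derivative with [g] is multiplication by the derivative of [g]. *)
  apply: (If (mderiv i)); split=> [|g a u v]; first exact: mderiv_is_linear.
  rewrite /= !mderivM !addrK /GRing.scale /= mulrDr.
  by congr (_ + _); rewrite mulrCA.
pose d g := delta g - g * delta 1.
have lin_d : linear d.
  move=> a u v; rewrite /d lin_delta mulrDl opprD addrACA scalerBr.
  by rewrite -scalerAl.
have leib_d u v : d (u * v) = u * d v + d u * v.
  by rewrite /d (diff_op1_mul u v diff_delta); ring.
have -> : delta f = d f + delta 1 * f by rewrite /d mulrC subrK.
apply: (ID); last exact: IM.
rewrite (derivation_mpolyE lin_d leib_d).
by apply: (big_ind I) => // i _; rewrite mulrC; apply: IM.
Qed.

Lemma has_characteristic_dvdn (K : fieldType) (p a : nat) :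
  has_characteristic K p -> (a%:R == 0 :> K) = (p %| a)%N.
Proof.
rewrite /has_characteristic; case: eqP => [->|_] charK.
  by rewrite dvd0n; move/pcharf0P: charK.
by rewrite (dvdn_pcharf charK).
Qed.

(** The truncated subtraction is harmless: [p] divides 0, so the second clause only concerns
    positive [m i]. *)
Definition diff_exponent (n p : nat) (M : 'X_{1..n} -> Prop)
    (m : 'X_{1..n}) : Prop :=
  M m /\ forall i, ~~ (p %| m i)%N -> M (m - U_(i))%MM.

(** Partial derivatives cause no cancellation between terms: only the term of exponent [m]
    contributes to the monomial [m - U_(i)] when [m i] is positive, and its coefficient is
    multiplied by [m i], which vanishes in [K] exactly when [p] divides [m i]. *)
Lemma diff_ideal_monomialP (K : fieldType) (p n : nat)
    (I : set {mpoly K[n]}) (M : 'X_{1..n} -> Prop) f :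
  has_characteristic K p -> is_ideal I ->
  (forall g, I g <-> forall m, m \in msupp g -> M m) ->
  diff_ideal I f <-> forall m, m \in msupp f -> diff_exponent p M m.
Proof.
move=> charK idI IP; rewrite (diff_idealP _ idI) IP.
split=> [[Mf Mdf] m mf|Df].
  split=> [|i ndvd]; first exact: Mf.
  have m_gt0 : (0 < m i)%N by rewrite lt0n; apply: contraNneq ndvd => ->.
  move/IP: (Mdf i); apply; rewrite mcoeff_msupp mcoeff_deriv mnmBE mnm1E eqxx.
  rewrite submK ?lep1mP -?lt0n // subn1 prednK // -mulr_natr mulf_neq0 //.
    by rewrite -mcoeff_msupp.
  by rewrite (has_characteristic_dvdn _ charK).
split=> [m /Df [] //|i]; apply/IP => m.
rewrite mcoeff_msupp mcoeff_deriv -mulr_natr mulf_eq0 negb_or => /andP[fm].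
rewrite (has_characteristic_dvdn _ charK) => ndvd.
have [_ /(_ i)] : diff_exponent p M (m + U_(i)).
  by apply: Df; rewrite mcoeff_msupp.
by rewrite mnmDE mnm1E eqxx addn1 addmK; apply.
Qed.

(* This property alone explains the case distinction in [mixed_exponent]. *)
Lemma mixed_exponent_leq (p : nat) (s : seq nat) (c : nat) : s != [::] ->
  (mixed_exponent p s <= c)%N <->
  (forall b, b \in s -> b <= c)%N /\
  (~~ (p %| c)%N -> exists2 b, b \in s & (b < c)%N).
Proof.
case: s => // a s _; rewrite /mixed_exponent /= eqxx /=.
case: allP => [all_a|not_all].
  have mem_a b : b \in a :: s -> b = a.
    by rewrite inE => /orP[/eqP //|/all_a /eqP].
  (* The case of zero exponents is an instance of the divisible case. *)
  have -> : (if a == 0 then 0 else if p %| a then a else a.+1)%N =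
            (if p %| a then a else a.+1)%N.
    by case: (a =P 0%N) => // ->; rewrite dvdn0.
  split=> [le_c|[le_c lt_c]].
    have le_ac : (a <= c)%N by move: le_c; case: ifP => // _ /ltnW.
    split=> [b /mem_a -> //|ndvd]; exists a; first exact: mem_head.
    rewrite ltn_neqAle le_ac andbT; apply: contraNneq ndvd => eq_ac.
    by move: le_c; rewrite -eq_ac; case: ifP => //; rewrite ltnn.
  case: ifP => dvd_a; first by apply: le_c; exact: mem_head.
  have le_ac : (a <= c)%N by apply: le_c; exact: mem_head.
  move: le_ac; rewrite leq_eqVlt => /orP[/eqP eq_ac|//].
  by have [|b /mem_a ->] := lt_c; rewrite // -eq_ac dvd_a.
split=> [/bigmax_leqP_seq le_c|[le_c _]]; last first.
  by apply/bigmax_leqP_seq => b bs _; exact: le_c.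
have {}le_c b : b \in a :: s -> (b <= c)%N by move=> bs; exact: le_c.
(* Either the head is below [c], or it equals [c] and an entry different from it is below [c]. *)
split=> // _; have [lt_ac|le_ca] := ltnP a c.
  by exists a; first exact: mem_head.
have {le_ca} eq_ac : a = c.
  by apply/eqP; rewrite eqn_leq le_ca le_c ?mem_head.
have /hasP[b bs neq_b] : has (predC (pred1 a)) s.
  by rewrite has_predC; apply/allP.
have bs' : b \in a :: s by rewrite inE bs orbT.
by exists b; rewrite // ltn_neqAle le_c // andbT -eq_ac.
Qed.

Lemma diff_exponentP (n p r : nat) (t : 'I_r -> 'X_{1..n.+1})
    (m : 'X_{1..n.+1}) :
  (1 <= n)%N ->
  diff_exponent p (fun m => exists2 j, setT j & (t j <= m)%MM) m <->
  exists2 js : seq 'I_r,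
    (2 <= size js <= n.+1)%N /\ sorted leq [seq val j | j <- js] &
    (mixed_term p t js <= m)%MM.
Proof.
move=> n_ge1; split=> [[[j0 _ le_j0] M_sub]|].
  have /boolp.choice[j jP] (i : 'I_n.+1) : exists j : 'I_r,
      (t j <= m)%MM /\ (~~ (p %| m i)%N -> (t j i < m i)%N).
    (* If [p] divides [m i], any generator dividing the monomial will do. *)
    have [dvd_mi|ndvd] := boolP (p %| m i)%N; first by exists j0.
    have m_gt0 : (0 < m i)%N by rewrite lt0n; apply: contraNneq ndvd => ->.
    have [j _ le_j] := M_sub i ndvd; exists j; split=> [|_].
      exact: lepm_trans le_j (lem_subr _ _).
    have /mnm_lepP/(_ i) := le_j.
    by rewrite mnmBE mnm1E eqxx subn1 => /leq_ltn_trans; apply; rewrite prednK.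
  (* One index per variable, with repetitions kept, gives length [n.+1], which is at least 2 by
     [n_ge1]. *)
  pose js := sort (relpre val leq) [seq j i | i <- enum 'I_n.+1].
  have mem_js i : j i \in js by rewrite mem_sort map_f ?mem_enum.
  have size_js : size js = n.+1 by rewrite size_sort size_map size_enum_ord.
  exists js; first split.
  - by rewrite size_js leqnn andbT.
  - by rewrite sorted_map; apply: sort_sorted => x y; exact: leq_total.
  apply/mnm_lepP => i; rewrite mnmE; apply/mixed_exponent_leq.
    by rewrite -size_eq0 size_map size_js.
  split=> [b /mapP[k + ->]|ndvd].
    by rewrite mem_sort => /mapP[i' _ ->]; have [/mnm_lepP] := jP i'.
  by exists (t (j i) i); [exact: map_f | exact: (jP i).2].
case=> js [/andP[size_js _] _] /mnm_lepP le_m.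
case: js size_js le_m => // j0 js _ le_m.
have {}le_m i : (forall b, b \in [seq t j i | j <- j0 :: js] -> b <= m i)%N /\
   (~~ (p %| m i)%N ->
    exists2 b, b \in [seq t j i | j <- j0 :: js] & (b < m i)%N).
  by apply/mixed_exponent_leq => //; have := le_m i; rewrite mnmE.
have le_mj j : j \in j0 :: js -> (t j <= m)%MM.
  by move=> js_j; apply/mnm_lepP => i; apply: (le_m i).1; apply/mapP; exists j.
split=> [|i /(le_m i).2[_ /mapP[j js_j ->] lt_m]].
  by exists j0 => //; apply/le_mj/mem_head.
(* A generator that divides the monomial and has a strictly smaller exponent at [i] still divides
   after one factor of the [i]-th variable is removed. *)
exists j => //; apply/mnm_lepP => i'; rewrite mnmBE mnm1E.
have /mnm_lepP/(_ i') := le_mj j js_j.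
case: eqP => [<- _|_]; rewrite ?subn0 // subn1 -ltnS prednK //.
exact: leq_ltn_trans lt_m.
Qed.

Lemma mixed_termsE (K : fieldType) (n p r : nat) (t : 'I_r -> 'X_{1..n.+1}) :
  @mixed_terms K n p r t = [set 'X_[mixed_term p t js] | js in
    [set js | (2 <= size js <= n.+1)%N /\ sorted leq [seq val j | j <- js]]].
Proof.
apply/seteqP; split=> [f [js [size_js sort_js ->]]|_ [js [size_js sort_js] <-]].
  by exists js.
by exists js.
Qed.

Theorem theorem1p2 (K : fieldType) (p n : nat) (X : closed_subscheme K n)
    (r : nat) (t : 'I_r -> 'X_{1..n.+1})
    (perfK : perfect_field K) (charK : has_characteristic K p)
    (n_ge1 : (1 <= n)%N) (dimX : has_dim X 0)
    (properX : is_proper (vanishing_ideal X))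
    (monX : monomial_ideal (vanishing_ideal X))
    (gensX : minimally_generated_by t (vanishing_ideal X)) :
  (monomial_ideal (diff_ideal (vanishing_ideal X)) /\
   diff_ideal (vanishing_ideal X) `<=` vanishing_ideal X) /\
  diff_ideal (vanishing_ideal X) = ideal_gen (mixed_terms p t).
Proof.
have idI := vanishing_ideal_ideal X.
have IP g : vanishing_ideal X g <-> forall m, m \in msupp g ->
    exists2 j, setT j & (t j <= m)%MM.
  by rewrite [vanishing_ideal X](proj1 gensX); exact: ideal_gen_monomialsP.
(* Both ideals are determined by a condition on the exponents in the support. Part (b) comes first,
   since monomiality in (a) is read off from it. *)
have diffE : diff_ideal (vanishing_ideal X) = ideal_gen (mixed_terms p t).
  apply/seteqP; split=> f; rewrite mixed_termsE ideal_gen_monomialsP.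
    move=> /(diff_ideal_monomialP _ charK idI IP) Df m mf.
    exact/diff_exponentP/Df.
  move=> Df; apply/(diff_ideal_monomialP _ charK idI IP).
  by move=> m mf; apply/diff_exponentP/Df.
split=> //; split; last by move=> f /(diff_idealP _ idI)[].
rewrite diffE mixed_termsE; exists (mixed_term p t @` [set js |
  (2 <= size js <= n.+1)%N /\ sorted leq [seq val j | j <- js]]).
by rewrite image_comp.
Qed.
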